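(* Let $\mathcal{A}_k=\operatorname{End}_{PG}(V_7^{\otimes k})$ be the centralizer algebra of $PG$ in $V_7^{\otimes k}$, where $PG$ acts diagonally on $V_7^{\otimes k}$. Then $\mathcal{A}_k$ has the following multi-matrix structure (isomorphism of $\mathbb{C}$-algebras): $$\mathcal{A}_k\cong\begin{cases}\mathbb{C} & (k=0),\\ \bigoplus_{\ell=1}^{10}M_{d_\ell(k)}(\mathbb{C}) & (k\ge 1),\end{cases}$$ where, with $a=-1-2i$, $b=-1+2i$ and $i=\sqrt{-1}$, $$\begin{aligned} d_1(k)&=\tfrac{3^k}{96}+\tfrac{a^k}{32}+\tfrac{b^k}{32}+\tfrac{5\cdot(-1)^k}{32}+\tfrac{3}{16}+\tfrac{i^k}{8}+\tfrac{(-i)^k}{8},\\ d_2(k)&=\tfrac{3^k}{96}+\tfrac{a^k}{32}+\tfrac{b^k}{32}-\tfrac{3\cdot(-1)^k}{32}-\tfrac{1}{16}-\tfrac{i^k}{8}-\tfrac{(-i)^k}{8},\\ d_3(k)&=\tfrac{3^k}{48}+\tfrac{a^k}{16}+\tfrac{b^k}{16}+\tfrac{(-1)^k}{16}+\tfrac{1}{8},\\ d_4(k)&=\tfrac{3^k}{32}-\tfrac{a^k}{32}-\tfrac{b^k}{32}+\tfrac{7\cdot(-1)^k}{32}+\tfrac{1}{16}-\tfrac{i^k}{8}-\tfrac{(-i)^k}{8},\\ d_5(k)&=\tfrac{3^k}{32}-\tfrac{a^k}{32}-\tfrac{b^k}{32}-\tfrac{(-1)^k}{32}-\tfrac{3}{16}+\tfrac{i^k}{8}+\tfrac{(-i)^k}{8},\\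 d_6(k)&=\tfrac{3^k}{32}+\tfrac{a\cdot a^k}{32}+\tfrac{b\cdot b^k}{32}-\tfrac{5\cdot(-1)^k}{32}+\tfrac{3}{16}+\tfrac{i\cdot i^k}{8}-\tfrac{i\cdot(-i)^k}{8},\\ d_7(k)&=\tfrac{3^k}{32}+\tfrac{b\cdot a^k}{32}+\tfrac{a\cdot b^k}{32}-\tfrac{5\cdot(-1)^k}{32}+\tfrac{3}{16}-\tfrac{i\cdot i^k}{8}+\tfrac{i\cdot(-i)^k}{8},\\ d_8(k)&=\tfrac{3^k}{32}+\tfrac{b\cdot a^k}{32}+\tfrac{a\cdot b^k}{32}+\tfrac{3\cdot(-1)^k}{32}-\tfrac{1}{16}+\tfrac{i\cdot i^k}{8}-\tfrac{i\cdot(-i)^k}{8},\\ d_9(k)&=\tfrac{3^k}{32}+\tfrac{a\cdot a^k}{32}+\tfrac{b\cdot b^k}{32}+\tfrac{3\cdot(-1)^k}{32}-\tfrac{1}{16}-\tfrac{i\cdot i^k}{8}+\tfrac{i\cdot(-i)^k}{8},\\ d_{10}(k)&=\tfrac{3^k}{16}+\tfrac{a^k}{16}+\tfrac{b^k}{16}-\tfrac{(-1)^k}{16}-\tfrac{1}{8}. \end{aligned}$$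
   Context: $G$ is the group (of order $384$) generated by $D$ and $T$ subject to the defining relations $D^8=1$, $T^8=1$, $T^2D=DT^2$, $TDT=D^7T^3D^7$, $TD^5T=D^3T^7D^3$. Its center is $Z=\{1,T^2,T^4,T^6\}$, and $PG=G/Z$ (a group of order $96$) is generated by $\bar D=DZ$ and $\bar T=TZ$. Let $\eta=\frac{1+i}{\sqrt2}$, a primitive $8$-th root of unity. $V_7=\mathbb{C}^3$ is the $PG$-module given by the representation $\rho_7$ of $PG$ determined by $$\rho_7(\bar D)=\operatorname{diag}(\eta,\,i,\,-\eta),\qquad \rho_7(\bar T)=\frac{-1}{2}\begin{pmatrix}1&2&1\\1&0&-1\\1&-2&1\end{pmatrix}.$$ $\operatorname{End}_{PG}(V_7^{\otimes k})$ is the algebra of $\mathbb{C}$-linear endomorphisms of $V_7^{\otimes k}$ commuting with the diagonal action of $PG$ ($V_7^{\otimes 0}=\mathbb{C}$ is the trivial module). $M_d(\mathbb{C})$ denotes the algebra of $d\times d$ matrices over $\mathbb{C}$, with $M_0(\mathbb{C})=0$. *)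

(* Defs.v *)
From HB Require Import structures.
From mathcomp Require Import all_boot all_order all_algebra.
From mathcomp Require Import all_fingroup all_solvable all_field all_character.
From mathcomp Require Import reals.
From mathcomp.real_closed Require Import complex.

Set Implicit Arguments.
Unset Strict Implicit.
Unset Printing Implicit Defensive.

Import Order.TTheory GRing.Theory Num.Theory.

Local Open Scope ring_scope.

(* [G \isog Grp p] says that G is the largest finite group with presentation  *)
(* p, but leaves the generators anonymous; the other two clauses fix D and T  *)
(* as the generators. As the presented group is finite, G is that group.      *)
Definition presented_by (gT : finGroupType) (G : {group gT}) (D T : gT) : Prop :=
  [/\ <<[set D; T]>>%g = G,
      [/\ D ^+ 8 = 1, T ^+ 8 = 1, T ^+ 2 * D = D * T ^+ 2,
          T * D * T = D ^+ 7 * T ^+ 3 * D ^+ 7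
        & T * D ^+ 5 * T = D ^+ 3 * T ^+ 7 * D ^+ 3]%g
    & (G \isog Grp (d : t : (d ^+ 8, t ^+ 8, t ^+ 2 * d = d * t ^+ 2,
          t * d * t = d ^+ 7 * t ^+ 3 * d ^+ 7,
          t * d ^+ 5 * t = d ^+ 3 * t ^+ 7 * d ^+ 3)))%g].

Section Rho7.

Variable C : numClosedFieldType.

Definition eta8 : C := (1 + 'i) / sqrtC 2.

Definition rho7_D : 'M[C]_3 :=
  diag_mx (\row_(j < 3) [:: eta8; 'i; - eta8]`_j).

Definition rho7_T : 'M[C]_3 :=
  (- 1 / 2) *:
  \matrix_(i < 3, j < 3)
    (nth [::] [:: [:: 1; 2; 1]; [:: 1; 0; - 1]; [:: 1; - 2; 1]] i)`_j.

End Rho7.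

Section TensorPower.

Variables (F : fieldType) (gT : finGroupType) (G : {group gT}).

Fact triv_mx_repr : mx_repr G (fun=> 1%:M : 'M[F]_1).
Proof. by split=> // x y _ _; rewrite mulmx1. Qed.
Definition triv_repr := MxRepresentation triv_mx_repr.

Variables (n : nat) (rG : mx_representation F G n).

(* n ^ k, computed so that tensor_repr typechecks without casts *)
Fixpoint tensor_dim (k : nat) : nat :=
  if k is k'.+1 then (tensor_dim k' * n)%N else 1%N.

Lemma tensor_dimE k : tensor_dim k = (n ^ k)%N.
Proof. by elim: k => //= k ->; rewrite expnSr. Qed.

Fixpoint tensor_repr (k : nat) : mx_representation F G (tensor_dim k) :=
  match k with
  | 0 => triv_repr
  | k'.+1 => prod_repr (tensor_repr k') rG
  end.

End TensorPower.

(* The algebra of endomorphisms of the module afforded by rG. A matrix stands *)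
(* for the endomorphism v |-> A *m v of column vectors, so that composition   *)
(* is matrix product. M_0 is the zero ring while the algebra structures of    *)
(* ssralg are nontrivial, hence only the ring and the module structures.      *)
Section CentralizerAlgebra.

Variables (F : fieldType) (gT : finGroupType) (G : {group gT}).
Variables (n : nat) (rG : mx_representation F G n).

Record cent_alg := CentAlg { cent_val :> 'M[F]_n; _ : centgmx rG cent_val }.

HB.instance Definition _ := [isSub for cent_val].
HB.instance Definition _ := [Choice of cent_alg by <:].

Fact centgmx_subring : subring_closed (centgmx rG).
Proof.
split=> [|A B /centgmxP cA /centgmxP cB|A B /centgmxP cA /centgmxP cB];
  apply/centgmxP=> x Gx.
- by rewrite mul1mx mulmx1.
- by rewrite mulmxBl mulmxBr cA ?cB.
- by rewrite -mulmxE -mulmxA cB // !mulmxA cA.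
Qed.

HB.instance Definition _ :=
  GRing.SubChoice_isSubPzRing.Build _ _ cent_alg centgmx_subring.

Fact centgmx_subsemimod : GRing.subsemimod_closed (centgmx rG).
Proof.
split=> [|a A /centgmxP cA].
  split=> [|A B /centgmxP cA /centgmxP cB]; apply/centgmxP=> x Gx.
    by rewrite mul0mx mulmx0.
  by rewrite mulmxDl mulmxDr cA ?cB.
by apply/centgmxP=> x Gx; rewrite -scalemxAl -scalemxAr cA.
Qed.

HB.instance Definition _ :=
  GRing.SubZmodule_isSubLmodule.Build F _ _ cent_alg centgmx_subsemimod.

End CentralizerAlgebra.

Definition dims (C : numClosedFieldType) (l k : nat) : C :=
  let a : C := - 1 - 2 * 'i in
  let b : C := - 1 + 2 * 'i in
  match l with
  | 1 => 3 ^+ k / 96 + a ^+ k / 32 + b ^+ k / 32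
         + 5 * (- 1) ^+ k / 32 + 3 / 16 + 'i ^+ k / 8 + (- 'i) ^+ k / 8
  | 2 => 3 ^+ k / 96 + a ^+ k / 32 + b ^+ k / 32
         - 3 * (- 1) ^+ k / 32 - 1 / 16 - 'i ^+ k / 8 - (- 'i) ^+ k / 8
  | 3 => 3 ^+ k / 48 + a ^+ k / 16 + b ^+ k / 16 + (- 1) ^+ k / 16 + 1 / 8
  | 4 => 3 ^+ k / 32 - a ^+ k / 32 - b ^+ k / 32
         + 7 * (- 1) ^+ k / 32 + 1 / 16 - 'i ^+ k / 8 - (- 'i) ^+ k / 8
  | 5 => 3 ^+ k / 32 - a ^+ k / 32 - b ^+ k / 32
         - (- 1) ^+ k / 32 - 3 / 16 + 'i ^+ k / 8 + (- 'i) ^+ k / 8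
  | 6 => 3 ^+ k / 32 + a * a ^+ k / 32 + b * b ^+ k / 32
         - 5 * (- 1) ^+ k / 32 + 3 / 16
         + 'i * 'i ^+ k / 8 - 'i * (- 'i) ^+ k / 8
  | 7 => 3 ^+ k / 32 + b * a ^+ k / 32 + a * b ^+ k / 32
         - 5 * (- 1) ^+ k / 32 + 3 / 16
         - 'i * 'i ^+ k / 8 + 'i * (- 'i) ^+ k / 8
  | 8 => 3 ^+ k / 32 + b * a ^+ k / 32 + a * b ^+ k / 32
         + 3 * (- 1) ^+ k / 32 - 1 / 16
         + 'i * 'i ^+ k / 8 - 'i * (- 'i) ^+ k / 8
  | 9 => 3 ^+ k / 32 + a * a ^+ k / 32 + b * b ^+ k / 32
         + 3 * (- 1) ^+ k / 32 - 1 / 16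
         - 'i * 'i ^+ k / 8 + 'i * (- 'i) ^+ k / 8
  | 10 => 3 ^+ k / 16 + a ^+ k / 16 + b ^+ k / 16 - (- 1) ^+ k / 16 - 1 / 8
  | _ => 0
  end.

(* Main.v *)
(* Up to the change of basis [basis3], the matrices of D and T generate the    *)
(* group Delta(96) of all 3 x 3 monomial matrices with entries in {1, i, -1,   *)
(* -i} and determinant 1, a semidirect product of Z_4 x Z_4 by the symmetric   *)
(* group of degree 3. Only this image matters for the centralizer. Its group   *)
(* algebra has a basis eps x *m sig w, for eps x the idempotent of a character *)
(* x of Z_4 x Z_4 and sig w a permutation, in which matrix units of all ten    *)
(* blocks are very sparse. The images of these matrix units in V^(tensor k)    *)
(* identify the centralizer with a product of full matrix algebras, the l-th   *)
(* one having as its size the rank of a primitive idempotent p_l, hence the    *)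
(* trace of p_l. As \tr (g^(tensor k)) = (\tr g)^k, that trace is a linear     *)
(* combination of k-th powers of the traces of the monomial matrices.          *)
Require Import Defs.
From HB Require Import structures.
From mathcomp Require Import all_boot all_order all_algebra.
From mathcomp Require Import all_fingroup all_solvable all_field all_character.
From mathcomp Require Import reals.
From mathcomp.real_closed Require Import complex.
From mathcomp Require Import ring.

Import Order.TTheory GRing.Theory Num.Theory.

Set Implicit Arguments.
Unset Strict Implicit.
Unset Printing Implicit Defensive.

Local Open Scope ring_scope.

(** Let [p l] be a primitive idempotent in the [l]-th block of the algebra spanned by the group. An
    operator in the commutant preserves the image of [p l], the ten restrictions so obtained
    determine it, and conversely any ten operators on these images extend to the commutant by
    copying them along matrix units. Hence the commutant is a product of matrix algebras of sizes
    [\rank (p l)] ([cent_alg_units]); a size may be 0.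

    The ten blocks come from the orbits of the symmetric group on the 16 characters of Z_4 x Z_4:
    the fixed character gives degrees 1, 1, 2; each of three orbits of size 3, with stabiliser of
    order 2, gives degree 3 twice; the free orbit gives degree 6. The relations between the matrix
    units are checked once for all [k], by computation with integer coefficients ([urow_ucol],
    [ucol_urow], [urow_sym3_ucol]), and carried to the tensor power by [galg_val].

    The sizes are traces ([mxtrace_prim]). Diagonal elements contribute powers of 3, 1, -1, a, b,
    and reflections powers of 1, i, -1, -i. Rotations have trace 0 and drop out exactly when [k] is
    positive, so [k = 0] is treated apart. *)

(** * Idempotent matrices: rank factorisation and trace *)

Section Idempotents.

Variables (F : fieldType) (n : nat) (p : 'M[F]_n).
Hypothesis idem_p : p *m p = p.

(** Substituting [p = col_base p *m row_base p] in [p *m p = p], both outer factors cancel because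
    they have full rank. *)
Lemma row_base_mul_col_base : row_base p *m col_base p = 1%:M.
Proof.
apply: (row_free_inj (row_base_free p)); apply: (row_full_inj (col_base_full p)).
by rewrite mul1mx -mulmxA mulmxA !mulmx_base.
Qed.

Lemma mul_idem_col_base : p *m col_base p = col_base p.
Proof.
have := mulmx_base p => /(congr1 (mulmx^~ (col_base p))) /= <-.
by rewrite -mulmxA row_base_mul_col_base mulmx1.
Qed.

Lemma row_base_mul_idem : row_base p *m p = row_base p.
Proof.
have := mulmx_base p => /(congr1 (mulmx (row_base p))) /= <-.
by rewrite mulmxA row_base_mul_col_base mul1mx.
Qed.

Lemma mxtrace_idem : \tr p = (\rank p)%:R.
Proof.
have := mulmx_base p => /(congr1 mxtrace) <-.
by rewrite mxtrace_mulC row_base_mul_col_base mxtrace1.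
Qed.

End Idempotents.

(** * The commutant of an algebra given by matrix units *)

Section MatrixUnits.

Variables (F : fieldType) (gT : finGroupType) (G : {group gT}) (n : nat).
Variable rG : mx_representation F G n.
Variables (J : finType) (lab : J -> nat) (c r : J -> 'M[F]_n).
Variable p : nat -> 'M[F]_n.

(* The products c i *m r j with lab i = lab j are the matrix units of the     *)
(* blocks of the enveloping algebra; p l is a primitive idempotent of block l. *)
Hypothesis lab_range : forall j, (1 <= lab j <= 10)%N.
Hypothesis rcE : forall i j, r i *m c j = if i == j then p (lab j) else 0.
Hypothesis sum_cr : \sum_j c j *m r j = 1%:M.
Hypothesis base : forall l, (1 <= l <= 10)%N ->
  exists j, [/\ lab j = l, c j = p l & r j = p l].
Hypothesis c_p : forall j, c j *m p (lab j) = c j.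
Hypothesis p_r : forall j, p (lab j) *m r j = r j.
Hypothesis cent_c : forall X, centgmx rG X -> forall j, X *m c j = c j *m X.
Hypothesis units_cent : forall X,
  (forall i j, lab i = lab j -> X *m (c i *m r j) = c i *m r j *m X) ->
  centgmx rG X.

Let d l := \rank (p l).

Lemma unit_idem l : (1 <= l <= 10)%N -> p l *m p l = p l.
Proof. by move=> /base[j [<- cj rj]]; rewrite -{1}rj -cj rcE eqxx. Qed.

(** Compression to the image of [p l], with [col_base] as inclusion and [row_base] as projection; on
    the commutant it is the restriction. *)
Definition corner l (X : 'M[F]_n) : 'M[F]_(d l) :=
  row_base (p l) *m X *m col_base (p l).

Definition inflate l (Y : 'M[F]_(d l)) : 'M[F]_n :=
  col_base (p l) *m Y *m row_base (p l).

Lemma p_inflate l Y : (1 <= l <= 10)%N -> p l *m @inflate l Y = inflate Y.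
Proof.
move=> l10; rewrite /inflate -(mulmxA (col_base _)) mulmxA.
by rewrite mul_idem_col_base // unit_idem.
Qed.

Lemma inflate_p l Y : (1 <= l <= 10)%N -> @inflate l Y *m p l = inflate Y.
Proof. by move=> l10; rewrite -mulmxA row_base_mul_idem ?unit_idem. Qed.

Lemma corner_inflate l Y : (1 <= l <= 10)%N -> corner l (inflate Y) = Y.
Proof.
move=> /unit_idem pp; rewrite /corner /inflate.
rewrite -(mulmxA (col_base _)) mulmxA row_base_mul_col_base // mul1mx.
by rewrite -mulmxA row_base_mul_col_base // mulmx1.
Qed.

Lemma inflate_corner l X : inflate (corner l X) = p l *m X *m p l.
Proof.
rewrite /corner /inflate -(mulmxA (row_base _)) (mulmxA (col_base _)).
by rewrite mulmx_base -mulmxA -(mulmxA X) mulmx_base mulmxA.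
Qed.

(** [r j] carries the [j]-th summand of the space onto the image of [p (lab j)], where [Y] acts, and
    [c j] carries the result back. Summands with equal labels get the same operator, so the matrix
    units between them commute with the sum. *)
Definition spread (Y : forall l, 'M[F]_(d l)) : 'M[F]_n :=
  \sum_j c j *m inflate (Y (lab j)) *m r j.

Lemma r_spread Y j : r j *m spread Y = inflate (Y (lab j)) *m r j.
Proof.
rewrite mulmx_sumr (bigD1 j) //= big1 ?addr0 => [|i ij].
  by rewrite 2!mulmxA rcE eqxx p_inflate.
by rewrite 2!mulmxA rcE eq_sym (negPf ij) !mul0mx.
Qed.

Lemma spread_c Y j : spread Y *m c j = c j *m inflate (Y (lab j)).
Proof.
rewrite mulmx_suml (bigD1 j) //= big1 ?addr0 => [|i ij].
  by rewrite -2!mulmxA rcE eqxx inflate_p.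
by rewrite -2!mulmxA rcE (negPf ij) !mulmx0.
Qed.

Lemma spread_cent Y : centgmx rG (spread Y).
Proof.
apply: units_cent => i j ij.
by rewrite mulmxA spread_c -!mulmxA r_spread ij !mulmxA.
Qed.

Lemma corner_spread Y l : (1 <= l <= 10)%N -> corner l (spread Y) = Y l.
Proof.
move=> l10; have pp := unit_idem l10.
have pY : p l *m spread Y = inflate (Y l).
  have [j [lj _ rj]] := base l10.
  by rewrite -{1}rj r_spread; case: _ / lj in l10 rj *; rewrite rj inflate_p.
rewrite /corner -row_base_mul_idem // -[_ *m p l *m _]mulmxA pY.
exact: corner_inflate.
Qed.

Lemma spread_corner X : centgmx rG X -> spread (fun l => corner l X) = X.
Proof.
move=> cX; rewrite -[RHS]mulmx1 -sum_cr mulmx_sumr; apply: eq_bigr => j _.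
rewrite inflate_corner !mulmxA c_p -!mulmxA p_r mulmxA.
by rewrite -cent_c // -mulmxA.
Qed.

Lemma p_cent X l : (1 <= l <= 10)%N -> centgmx rG X -> X *m p l = p l *m X.
Proof. by move=> /base[j [_ <- _]] /cent_c. Qed.

Lemma cornerM l X X' : (1 <= l <= 10)%N -> centgmx rG X' ->
  corner l (X *m X') = corner l X *m corner l X'.
Proof.
move=> l10 cX'.
have E : col_base (p l) *m corner l X' = X' *m col_base (p l).
  rewrite /corner -(mulmxA (row_base _)) (mulmxA (col_base _)) mulmx_base.
  by rewrite mulmxA -p_cent // -mulmxA mul_idem_col_base ?unit_idem.
by rewrite [corner l X]/corner -(mulmxA _ (col_base _)) E [RHS]mulmxA /corner
  (mulmxA (row_base _)).
Qed.

Lemma corner1 l : (1 <= l <= 10)%N -> corner l 1%:M = 1%:M.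
Proof.
move=> l10; rewrite /corner mulmx1 row_base_mul_col_base //; exact: unit_idem.
Qed.

Definition corners (X : cent_alg rG) :
    ('M[F]_(d 1%N) * 'M[F]_(d 2%N) * 'M[F]_(d 3%N) * 'M[F]_(d 4%N)
     * 'M[F]_(d 5%N) * 'M[F]_(d 6%N) * 'M[F]_(d 7%N) * 'M[F]_(d 8%N)
     * 'M[F]_(d 9%N) * 'M[F]_(d 10%N))%type :=
  (corner 1 X, corner 2 X, corner 3 X, corner 4 X, corner 5 X, corner 6 X,
   corner 7 X, corner 8 X, corner 9 X, corner 10 X).

Lemma cornerB l : additive (corner l).
Proof. by move=> X Y; rewrite /corner mulmxBr mulmxBl. Qed.

Lemma cornerZ l a X : corner l (a *: X) = a *: corner l X.
Proof. by rewrite /corner -scalemxAr -scalemxAl. Qed.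

Fact corners_additive : additive corners.
Proof. by move=> X Y; rewrite /corners !cornerB. Qed.

Fact corners_scalable : scalable corners.
Proof.
move=> a X; rewrite /corners (_ : cent_val (a *: X) = a *: cent_val X) //.
by rewrite !cornerZ.
Qed.

Fact corners_monoid : monoid_morphism corners.
Proof.
split=> [|X Y]; first by rewrite /corners !corner1.
by rewrite /corners !cornerM //; case: Y.
Qed.

HB.instance Definition _ :=
  GRing.isZmodMorphism.Build _ _ corners corners_additive.
HB.instance Definition _ :=
  GRing.isMonoidMorphism.Build _ _ corners corners_monoid.

Lemma cent_alg_units :
  exists f : {rmorphism cent_alg rG ->
      ('M[F]_(d 1%N) * 'M[F]_(d 2%N) * 'M[F]_(d 3%N) * 'M[F]_(d 4%N)
       * 'M[F]_(d 5%N) * 'M[F]_(d 6%N) * 'M[F]_(d 7%N) * 'M[F]_(d 8%N)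
       * 'M[F]_(d 9%N) * 'M[F]_(d 10%N))%type},
    scalable f /\ bijective f.
Proof.
exists corners; split=> [a X|]; first exact: corners_scalable.
(* [spread] takes a family over all of [nat]; the default 0 is never reached, by [lab_range]. *)
pose fam (y : ('M[F]_(d 1%N) * 'M[F]_(d 2%N) * 'M[F]_(d 3%N) * 'M[F]_(d 4%N)
     * 'M[F]_(d 5%N) * 'M[F]_(d 6%N) * 'M[F]_(d 7%N) * 'M[F]_(d 8%N)
     * 'M[F]_(d 9%N) * 'M[F]_(d 10%N))%type) l : 'M[F]_(d l) :=
  let: (y1, y2, y3, y4, y5, y6, y7, y8, y9, y10) := y in
  match l return 'M[F]_(d l) with
  | 1 => y1 | 2 => y2 | 3 => y3 | 4 => y4 | 5 => y5
  | 6 => y6 | 7 => y7 | 8 => y8 | 9 => y9 | 10 => y10 | _ => 0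
  end.
exists (fun y => CentAlg (spread_cent (fam y))) => [X|y].
  apply: val_inj => /=; rewrite -[RHS]spread_corner; last by case: X.
  apply: eq_bigr => j _; congr (_ *m (_ *m _ *m _) *m _).
  by have := lab_range j; case: (lab j) => [|[|[|[|[|[|[|[|[|[|[|l]]]]]]]]]]].
transitivity (fam y 1, fam y 2, fam y 3, fam y 4, fam y 5, fam y 6, fam y 7,
              fam y 8, fam y 9, fam y 10)%N.
  by rewrite -!(corner_spread (fam y)).
by move: y => [[[[[[[[[? ?] ?] ?] ?] ?] ?] ?] ?] ?].
Qed.

End MatrixUnits.

(** * Tensor powers of operators *)

Section TensorPowers.

Variables (F : fieldType) (n : nat).

Fixpoint tensor_mx k (X : 'M[F]_n) : 'M[F]_(tensor_dim n k) :=
  if k is k'.+1 then tprod (tensor_mx k' X) X else 1%:M.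

Lemma tensor_mx1 k : tensor_mx k 1%:M = 1%:M.
Proof. by elim: k => //= k ->; rewrite tprod1. Qed.

Lemma tensor_mxM k X Y : tensor_mx k (X *m Y) = tensor_mx k X *m tensor_mx k Y.
Proof. by elim: k => [|k /= ->]; rewrite ?mulmx1 // tprodE. Qed.

Lemma mxtrace_tensor_mx k X : \tr (tensor_mx k X) = \tr X ^+ k.
Proof. by elim: k => [|k IH]; rewrite ?mxtrace1 //= mxtrace_prod IH exprSr. Qed.

Lemma tensor_reprE (gT : finGroupType) (G : {group gT})
    (rG : mx_representation F G n) k x :
  tensor_repr rG k x = tensor_mx k (rG x).
Proof. by elim: k => //= k ->. Qed.

End TensorPowers.

(** * The monomial group and the matrices of D and T *)

Definition mx3 (R : Type) (a b c d e f g h k : R) : 'M[R]_3 :=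
  \matrix_(i < 3, j < 3)
    nth a (nth [::] [:: [:: a; b; c]; [:: d; e; f]; [:: g; h; k]] i) j.

Lemma mx3M (R : comNzRingType)
    (a b c d e f g h k a' b' c' d' e' f' g' h' k' : R) :
  mx3 a b c d e f g h k *m mx3 a' b' c' d' e' f' g' h' k' =
  mx3 (a * a' + b * d' + c * g') (a * b' + b * e' + c * h')
      (a * c' + b * f' + c * k')
      (d * a' + e * d' + f * g') (d * b' + e * e' + f * h')
      (d * c' + e * f' + f * k')
      (g * a' + h * d' + k * g') (g * b' + h * e' + k * h')
      (g * c' + h * f' + k * k').
Proof.
apply/matrixP => -[[|[|[|//]]] ?] -[[|[|[|//]]] ?];
  by rewrite !mxE !big_ord_recl big_ord0 !mxE addr0 addrA.
Qed.

Lemma mxtrace_mx3 (R : comNzRingType) (a b c d e f g h k : R) :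
  \tr (mx3 a b c d e f g h k) = a + e + k.
Proof. by rewrite /mxtrace !big_ord_recl big_ord0 !mxE addr0 addrA. Qed.

Lemma mx3_1 (R : comNzRingType) : 1%:M = mx3 1 0 0 0 1 0 0 0 1 :> 'M[R]_3.
Proof.
by apply/matrixP => -[[|[|[|//]]] ?] -[[|[|[|//]]] ?]; rewrite !mxE.
Qed.

Section MonomialGroup.

Variable C : numClosedFieldType.

Definition chi (z : 'Z_4) : C := 'i ^+ z.

Lemma i4 : 'i ^+ 4 = 1 :> C.
Proof. by rewrite (exprM _ 2 2) sqrCi sqrrN expr1n. Qed.

Lemma chiD z w : chi (z + w) = chi z * chi w.
Proof. by rewrite /chi /= (expr_mod _ i4) exprD. Qed.

Definition diag3 (a : 'Z_4 * 'Z_4) : 'M[C]_3 :=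
  mx3 (chi a.1) 0 0 0 (chi a.2) 0 0 0 (chi (- a.1 - a.2)).

(** Matrices of transpositions, negated to have determinant 1. *)
Definition s3 : 'M[C]_3 := mx3 0 (-1) 0 (-1) 0 0 0 0 (-1).
Definition t3 : 'M[C]_3 := mx3 (-1) 0 0 0 0 (-1) 0 (-1) 0.

Lemma diag3D a b : diag3 (a + b) = diag3 a *m diag3 b.
Proof.
rewrite /diag3 mx3M; congr mx3; rewrite /= ?mul0r ?mulr0 ?addr0 ?add0r // -chiD //.
by congr chi; ring.
Qed.

Lemma diag3_0 : diag3 0 = 1%:M.
Proof. by rewrite mx3_1. Qed.

Lemma s3_diag3 a : s3 *m diag3 a = diag3 (a.2, a.1) *m s3.
Proof.
rewrite /diag3 !mx3M; congr mx3; rewrite /= ?[- a.2 - a.1]addrC; ring.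
Qed.

Lemma t3_diag3 a : t3 *m diag3 a = diag3 (a.1, - a.1 - a.2) *m t3.
Proof.
rewrite /diag3 !mx3M /= (_ : - a.1 - (- a.1 - a.2) = a.2); last by ring.
congr mx3; ring.
Qed.

Lemma s3s3 : s3 *m s3 = 1%:M.
Proof. rewrite mx3_1 mx3M; congr mx3; ring. Qed.

Lemma t3t3 : t3 *m t3 = 1%:M.
Proof. rewrite mx3_1 mx3M; congr mx3; ring. Qed.

Lemma braid3 : s3 *m t3 *m s3 = t3 *m s3 *m t3.
Proof. rewrite !mx3M; congr mx3; ring. Qed.

(* The columns are joint eigenvectors of the normal subgroup Z_4 x Z_4.       *)
Definition basis3 : 'M[C]_3 := mx3 (eta8 C) 1 0 0 0 1 (eta8 C) (-1) 0.
Definition cobasis3 : 'M[C]_3 :=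
  mx3 ((eta8 C)^-1 / 2) 0 ((eta8 C)^-1 / 2) (1 / 2) 0 (- 1 / 2) 0 1 0.

Lemma eta8_sq : eta8 C ^+ 2 = 'i.
Proof.
rewrite /eta8 expr_div_n sqrtCK sqrrD expr1n sqrCi mul1r.
by rewrite [1 + _ + _]addrAC subrr add0r -mulr_natl mulrC mulKf ?pnatr_eq0.
Qed.

Lemma eta8_neq0 : eta8 C != 0.
Proof. by apply: contraNneq (neq0Ci C) => e0; rewrite -eta8_sq e0 expr0n. Qed.

Lemma cobasis3K : cobasis3 *m basis3 = 1%:M.
Proof.
rewrite mx3_1 mx3M; have := eta8_neq0 => e0.
congr mx3; field; rewrite ?e0 ?pnatr_eq0 //.
Qed.

Lemma chi2 : chi 2 = -1.
Proof. by rewrite -sqrCi. Qed.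

Lemma chi3 : chi 3 = - 'i.
Proof. by rewrite -[LHS]/('i ^+ 3) exprS sqrCi mulrN1. Qed.

Lemma rho7_DE : rho7_D C = basis3 *m (diag3 (2, 3) *m s3) *m cobasis3.
Proof.
have -> : rho7_D C = mx3 (eta8 C) 0 0 0 'i 0 0 0 (- eta8 C).
  by apply/matrixP => -[[|[|[|//]]] ?] -[[|[|[|//]]] ?]; rewrite !mxE.
rewrite /diag3 (_ : - (2, 3).1 - (2, 3).2 = 3); last exact: val_inj.
(* Writing ['i] as the square of [eta8] leaves identities of rational functions in [eta8] alone. *)
rewrite !mx3M /= chi2 chi3 -eta8_sq; have e0 := eta8_neq0.
by congr mx3; field.
Qed.

Lemma rho7_TE : rho7_T C = basis3 *m t3 *m cobasis3.
Proof.
have -> : rho7_T C = mx3 (- 1 / 2) (- 1) (- 1 / 2) (- 1 / 2) 0 (1 / 2)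
                         (- 1 / 2) 1 (- 1 / 2).
  apply/matrixP => -[[|[|[|//]]] ?] -[[|[|[|//]]] ?]; rewrite !mxE /=; by field.
by rewrite !mx3M; have e0 := eta8_neq0; congr mx3; field.
Qed.

End MonomialGroup.

(** * Characters of Z_4 x Z_4 and the symmetric group *)

Notation weight := ('Z_4 * 'Z_4)%type.
Notation sym3 := ('Z_3 * bool)%type.

Definition pairing (x a : weight) : 'Z_4 := x.1 * a.1 + x.2 * a.2.

(** Adjoints, for [pairing], of the conjugations by [s3] and [t3] on exponents of diagonal matrices;
    [t3] sends [(a1, a2)] to [(a1, - a1 - a2)]. *)
Definition act_s (x : weight) : weight := (x.2, x.1).
Definition act_t (x : weight) : weight := (x.1 - x.2, - x.2).
(* (j, b) stands for the element (s t)^j t^b of the symmetric group.          *)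
Definition act (w : sym3) (x : weight) : weight :=
  iter w.1 (act_s \o act_t) (iter w.2 act_t x).
Definition mul3 (w w' : sym3) : sym3 :=
  (w.1 + (if w.2 then - w'.1 else w'.1), w.2 (+) w'.2).
Definition inv3 (w : sym3) : sym3 := if w.2 then w else (- w.1, false).

Section CharacterSums.

Variable C : numClosedFieldType.

Lemma sum_chi z : \sum_x chi C (z * x) = if z == 0 then 4 else 0.
Proof.
have i2 := sqrCi C; have i3 : 'i ^+ 3 = - 'i :> C by rewrite exprS i2 mulrN1.
rewrite !big_ord_recl big_ord0 /chi.
case: z => -[|[|[|[|//]]]] ?; rewrite -[_ == _]/(_ == _ :> nat) /=.
- by rewrite -[LHS]/(1 + (1 + (1 + (1 + 0)))); ring.
- by rewrite -[LHS]/(1 + ('i + ('i ^+ 2 + ('i ^+ 3 + 0)))) i3 i2; ring.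
- by rewrite -[LHS]/(1 + ('i ^+ 2 + (1 + ('i ^+ 2 + 0)))) i2; ring.
- by rewrite -[LHS]/(1 + ('i ^+ 3 + ('i ^+ 2 + ('i + 0)))) i3 i2; ring.
Qed.

Lemma sum_chi_pairing x : \sum_a chi C (pairing x a) = if x == 0 then 16 else 0.
Proof.
rewrite (eq_bigr (fun a => chi C (x.1 * a.1) * chi C (x.2 * a.2))); last first.
  by move=> a _; rewrite chiD.
rewrite -(pair_bigA _ (fun a b => chi C (x.1 * a) * chi C (x.2 * b))) /=.
rewrite -big_distrlr /= !sum_chi; case: x => x1 x2 /=.
have -> : ((x1, x2) == 0) = (x1 == 0) && (x2 == 0) by [].
by do 2![case: eqP => _ /=]; rewrite ?mulr0 ?mul0r // -natrM.
Qed.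

End CharacterSums.


(** * Exact computation in the group algebra *)

(* The group algebra of Delta(96) in the basis eps x *m sig w, as lists of    *)
(* integer coefficients attached to pairs (x, w).                             *)
Notation galg := (seq (int * (weight * sym3))).

Definition coef (x : galg) k : int :=
  foldr (fun z a => if z.2 == k then z.1 + a else a) 0 x.
Definition galg_eq (x y : galg) : bool :=
  all (fun z => coef x z.2 == coef y z.2) (x ++ y).
Definition galg_scale (m : int) (x : galg) : galg :=
  [seq (m * z.1, z.2) | z <- x].
(** Moving [sig w] past [eps y] gives [eps (act w y)], and distinct [eps] are orthogonal, which
    explains the filter. *)
Definition galg_mul (x y : galg) : galg :=
  [seq (z.1 * z'.1, (z.2.1, mul3 z.2.2 z'.2.2))
     | z <- x, z' <- [seq z' <- y | z.2.1 == act z.2.2 z'.2.1]].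
Definition lmul3 (w : sym3) (x : galg) : galg :=
  [seq (z.1, (act w z.2.1, mul3 w z.2.2)) | z <- x].
Definition rmul3 (x : galg) (w : sym3) : galg :=
  [seq (z.1, (z.2.1, mul3 z.2.2 w)) | z <- x].

Definition all_Z4 : seq 'Z_4 := [:: 0; 1; 2; 3].
Definition all_sym3 : seq sym3 :=
  [seq (j, b) | b <- [:: false; true], j <- [:: 0; 1; 2]].
Definition galg1 : galg :=
  [seq (1, ((u, v), (0, false))) | u <- all_Z4, v <- all_Z4].

(* Block l (1 <= l <= 10) is induced from an irreducible representation of    *)
(* the stabiliser of the character block_weight l of Z_4 x Z_4, which extends *)
(* that character except for l = 3, where it has degree 2; block_prim l is 6  *)
(* times a primitive idempotent, and its translates by block_reps l span a    *)
(* minimal left ideal.                                                        *)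
Definition block_weight (l : nat) : weight :=
  nth (0, 0) [:: (0, 0); (0, 0); (0, 0); (0, 0); (2, 0); (2, 0); (3, 0); (1, 0);
                 (1, 0); (3, 0); (1, 2)] l.
Definition block_coefs (l : nat) : seq int :=
  nth [::] [:: [::]; [:: 1; 1; 1; 1; 1; 1]; [:: 1; 1; 1; -1; -1; -1];
    [:: 2; -2; 0; 0; -2; 2]; [:: 3; 0; 0; 3]; [:: 3; 0; 0; -3]; [:: 3; 0; 0; -3];
    [:: 3; 0; 0; -3]; [:: 3; 0; 0; 3]; [:: 3; 0; 0; 3]; [:: 6]] l.
Definition block_prim (l : nat) : galg :=
  [seq (z.1, (block_weight l, z.2)) | z <- zip (block_coefs l) all_sym3].
Definition block_reps (l : nat) : seq sym3 :=
  if (l <= 2)%N then [:: (0, false)]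
  else if (l == 3)%N then [:: (0, false); (0, true)]
  else if (l <= 9)%N then [:: (0, false); (1, false); (2, false)]
  else all_sym3.

Definition units : seq (nat * sym3) :=
  [seq (l, w) | l <- iota 1 10, w <- block_reps l].
Definition ucol (u : nat * sym3) : galg := lmul3 u.2 (block_prim u.1).
Definition urow (u : nat * sym3) : galg := rmul3 (block_prim u.1) (inv3 u.2).

(** Two translates in one block usually have different weights, hence are orthogonal. In block 3 the
    weights agree, and the idempotent [p] is chosen so that [p t p = 0]. Blocks sharing a weight
    orbit are separated by orthogonal idempotents of the stabiliser. *)
Lemma urow_ucol : all (fun u => all (fun v =>
  galg_eq (galg_mul (urow u) (ucol v))
          (if u == v then galg_scale 6 (block_prim v.1) else [::])) units) units.
Proof. by lazy. Qed.

Lemma ucol_urow :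
  galg_eq (flatten [seq galg_mul (ucol u) (urow u) | u <- units])
          (galg_scale 36 galg1).
Proof. by lazy. Qed.

Lemma ucol_prim : all (fun u =>
  galg_eq (galg_mul (ucol u) (block_prim u.1)) (galg_scale 6 (ucol u))) units.
Proof. by lazy. Qed.

Lemma prim_urow : all (fun u =>
  galg_eq (galg_mul (block_prim u.1) (urow u)) (galg_scale 6 (urow u))) units.
Proof. by lazy. Qed.

Lemma ucol_weight : all (fun u =>
  all (fun z => z.2.1 == act u.2 (block_weight u.1)) (ucol u)) units.
Proof. by lazy. Qed.

(* The coefficients of (block_weight l, 1) reveal the scalar by which         *)
(* urow u * w * ucol v is a multiple of block_prim l.                         *)
Lemma urow_sym3_ucol : all (fun w => all (fun u => all (fun v =>
  let x := galg_mul (urow u) (lmul3 w (ucol v)) in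
  let p := block_prim v.1 in
  let k := (block_weight v.1, (0, false)) in
  if u.1 == v.1
  then (coef p k != 0)
       && galg_eq (galg_scale (coef p k) x) (galg_scale (coef x k) p)
  else galg_eq x [::]) units) units) [:: (1, false); (0, true)].
Proof. by lazy. Qed.

(** * Character idempotents and permutations as matrices *)

Section CrossedProduct.

Variables (C : numClosedFieldType) (n : nat).
Variables (N : weight -> 'M[C]_n) (s t : 'M[C]_n).

Hypothesis N0 : N 0 = 1%:M.
Hypothesis ND : forall a b, N (a + b) = N a *m N b.
Hypothesis sN : forall a, s *m N a = N (a.2, a.1) *m s.
Hypothesis tN : forall a, t *m N a = N (a.1, - a.1 - a.2) *m t.
Hypothesis ss : s *m s = 1%:M.
Hypothesis tt : t *m t = 1%:M.
Hypothesis braid : s *m t *m s = t *m s *m t.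

Definition eps (x : weight) : 'M[C]_n :=
  16^-1 *: \sum_a chi C (- pairing x a) *: N a.

Lemma N_eps a x : N a *m eps x = chi C (pairing x a) *: eps x.
Proof.
rewrite /eps -scalemxAr scalerA mulrC -scalerA; congr (_ *: _).
rewrite mulmx_sumr [in RHS](reindex_inj (addrI a)) scaler_sumr /=.
apply: eq_bigr => b _; rewrite -scalemxAr -ND scalerA -chiD; congr (chi _ _ *: _).
by rewrite /pairing /=; ring.
Qed.

Lemma eps_mul x y : eps x *m eps y = if x == y then eps x else 0.
Proof.
rewrite {1}/eps -scalemxAl mulmx_suml.
rewrite (eq_bigr (fun a => chi C (pairing (y - x) a) *: eps y)) => [|a _].
  rewrite -scaler_suml sum_chi_pairing scalerA subr_eq0 eq_sym.
  by case: eqP => [->|_]; rewrite ?mulr0 ?scale0r // mulVf ?scale1r ?pnatr_eq0.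
rewrite -scalemxAl N_eps scalerA -chiD; congr (chi _ _ *: _).
by rewrite /pairing /=; ring.
Qed.

Lemma sum_eps : \sum_x eps x = 1%:M.
Proof.
rewrite -scaler_sumr exchange_big /=.
rewrite (eq_bigr (fun a => (if a == 0 then 16 else 0) *: N a)) => [|a _].
  rewrite (bigD1 (0 : weight)) //= big1 => [|a /negPf->].
    by rewrite addr0 N0 scalerA mulVf ?scale1r ?pnatr_eq0.
  by rewrite scale0r.
rewrite -scaler_suml -(oppr_eq0 a) -sum_chi_pairing; congr (_ *: _).
by apply: eq_bigr => x _; congr chi; rewrite /pairing /=; ring.
Qed.

Lemma s_eps x : s *m eps x = eps (act_s x) *m s.
Proof.
rewrite /eps -scalemxAl -scalemxAr; congr (_ *: _).
rewrite mulmx_sumr mulmx_suml [in RHS](reindex_inj (h := act_s)) /=; last first.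
  by move=> [? ?] [? ?] [-> ->].
apply: eq_bigr => a _; rewrite -scalemxAl -scalemxAr sN.
by congr (chi _ _ *: _); rewrite /pairing /=; ring.
Qed.

Lemma t_eps x : t *m eps x = eps (act_t x) *m t.
Proof.
rewrite /eps -scalemxAl -scalemxAr; congr (_ *: _).
pose h (a : weight) : weight := (a.1, - a.1 - a.2).
have hK : involutive h by case=> a b; rewrite /h /=; congr (_, _); ring.
rewrite mulmx_sumr mulmx_suml [in RHS](reindex_inj (inv_inj hK)) /=.
apply: eq_bigr => a _; rewrite -scalemxAl -scalemxAr tN.
by congr (chi _ _ *: _); rewrite /pairing /=; ring.
Qed.

Definition sig (w : sym3) : 'M[C]_n := (s *m t) ^+ w.1 *m t ^+ w.2.

Lemma sig_eps w x : sig w *m eps x = eps (act w x) *m sig w.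
Proof.
rewrite /sig /act -!mulmxA.
have -> : t ^+ w.2 *m eps x = eps (iter w.2 act_t x) *m t ^+ w.2.
  by case: w.2; rewrite ?expr1 ?t_eps // expr0 mulmxE mul1r mulr1.
rewrite !mulmxA; congr (_ *m _).
elim: (nat_of_ord w.1) => [|j IH] /=; first by rewrite expr0 mulmxE mulr1 mul1r.
rewrite exprS -!mulmxE -!mulmxA IH !mulmxA; congr (_ *m _).
by rewrite -!mulmxA t_eps mulmxA s_eps -!mulmxA.
Qed.

Lemma st3 : (s *m t) ^+ 3 = 1.
Proof.
have e : (s *m t *m s) *m (t *m s *m t) = 1%:M.
  by rewrite -braid -!mulmxA (mulmxA s s) ss mul1mx (mulmxA t t) tt mul1mx.
by rewrite !exprS expr0 mulr1 -!mulmxE !mulmxA -[RHS]e !mulmxA.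
Qed.

Lemma t_st (j : 'Z_3) : t *m (s *m t) ^+ j = (s *m t) ^+ (- j : 'Z_3) *m t.
Proof.
have st2 : s *m t *m (s *m t) = t *m s.
  by rewrite mulmxA braid -!mulmxA tt mulmx1.
have t1 : t *m (s *m t) = s *m t *m (s *m t) *m t by rewrite st2 mulmxA.
have t2 : t *m (s *m t *m (s *m t)) = s *m t *m t.
  by rewrite st2 mulmxA tt mul1mx -mulmxA tt mulmx1.
by case: j => -[|[|[|//]]] ?;
  rewrite /= ?expr0 ?expr1 ?expr2 -?mulmxE // ?mulmx1 ?mul1mx.
Qed.

Lemma sigM w w' : sig w *m sig w' = sig (mul3 w w').
Proof.
have stD (j k : 'Z_3) : (s *m t) ^+ (j + k)%R = (s *m t) ^+ j *m (s *m t) ^+ k.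
  by rewrite /= (expr_mod _ st3) exprD mulmxE.
case: w w' => [j b] [k b']; rewrite /sig /mul3 /= stD -!mulmxA; congr (_ *m _).
case: b; last by rewrite addFb expr0 mulmxE mul1r.
rewrite expr1 mulmxA t_st -!mulmxA; congr (_ *m _).
by case: b'; rewrite ?expr1 ?expr0 ?tt // mulmxE mulr1.
Qed.


Lemma sig1 : sig (0, false) = 1%:M.
Proof. by rewrite /sig !expr0 mulmxE mulr1. Qed.

End CrossedProduct.

Lemma sum_Z4 (V : nmodType) (F : 'Z_4 -> V) : \sum_(u <- all_Z4) F u = \sum_u F u.
Proof.
rewrite !big_cons big_nil !big_ord_recl big_ord0.
by do 4?[congr (_ + _)]; congr F; apply: val_inj.
Qed.

(** * Matrix units realised as matrices *)

Section GroupAlgebra.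

Variables (C : numClosedFieldType) (n : nat).
Variables (N eps : weight -> 'M[C]_n) (sig : sym3 -> 'M[C]_n).

Hypothesis N_eps : forall a x, N a *m eps x = chi C (pairing x a) *: eps x.
Hypothesis eps_mul : forall x y, eps x *m eps y = if x == y then eps x else 0.
Hypothesis sum_eps : \sum_x eps x = 1%:M.
Hypothesis sig_eps : forall w x, sig w *m eps x = eps (act w x) *m sig w.
Hypothesis sigM : forall w w', sig w *m sig w' = sig (mul3 w w').
Hypothesis sig1 : sig (0, false) = 1%:M.

Definition galg_val (x : galg) : 'M[C]_n :=
  \sum_(z <- x) z.1%:~R *: (eps z.2.1 *m sig z.2.2).

Lemma galg_val_coef x :
  galg_val x = \sum_k (coef x k)%:~R *: (eps k.1 *m sig k.2).
Proof.
elim: x => [|[m k] x IH]; rewrite /galg_val.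
  by rewrite big_nil big1 // => k _; rewrite scale0r.
rewrite big_cons -/(galg_val x) IH [RHS](bigD1 k) //= [in LHS](bigD1 k) //=.
rewrite eqxx intrD scalerDl addrA; congr (_ + _).
by apply: eq_bigr => k' /negPf kk'; rewrite eq_sym kk'.
Qed.

Lemma galg_valP x y : galg_eq x y -> galg_val x = galg_val y.
Proof.
move=> /allP xy; rewrite !galg_val_coef; apply: eq_bigr => k _.
have [/mapP[z /xy/eqP xyk ->]|] := boolP (k \in map snd (x ++ y)).
  by rewrite xyk.
have coef0 u : k \notin map snd u -> coef u k = 0.
  elim: u => //= z u IH; rewrite inE negb_or eq_sym => /andP[/negPf-> /IH //].
by rewrite map_cat mem_cat negb_or => /andP[/coef0-> /coef0->].
Qed.

Lemma galg_val_nil : galg_val [::] = 0. Proof. exact: big_nil. Qed.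

Lemma galg_val_scale m x : galg_val (galg_scale m x) = m%:~R *: galg_val x.
Proof.
rewrite /galg_val big_map scaler_sumr; apply: eq_bigr => z _ /=.
by rewrite intrM scalerA.
Qed.

Lemma galg_val_lmul3 w x : galg_val (lmul3 w x) = sig w *m galg_val x.
Proof.
rewrite /galg_val big_map mulmx_sumr; apply: eq_bigr => z _ /=.
by rewrite -scalemxAr mulmxA sig_eps -mulmxA sigM.
Qed.

Lemma galg_val_rmul3 w x : galg_val (rmul3 x w) = galg_val x *m sig w.
Proof.
rewrite /galg_val big_map mulmx_suml; apply: eq_bigr => z _ /=.
by rewrite -scalemxAl -mulmxA sigM.
Qed.

Lemma galg_val_mul x y : galg_val (galg_mul x y) = galg_val x *m galg_val y.
Proof.
rewrite /galg_val big_allpairs_dep mulmx_suml; apply: eq_bigr => z _ /=.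
rewrite big_filter mulmx_sumr big_mkcond; apply: eq_bigr => z' _ /=.
rewrite -scalemxAl -scalemxAr scalerA intrM -mulmxA (mulmxA (sig _)) sig_eps.
rewrite -(mulmxA (eps (act _ _))) sigM mulmxA eps_mul.
by case: eqP => _; rewrite ?mul0mx ?scaler0.
Qed.

Lemma galg_val_flatten xs : galg_val (flatten xs) = \sum_(x <- xs) galg_val x.
Proof. exact: big_flatten. Qed.

Lemma galg_val1 : galg_val galg1 = 1%:M.
Proof.
rewrite /galg_val big_allpairs_dep -sum_eps.
rewrite [RHS](eq_bigr (fun x => eps (x.1, x.2))) => [|[] //].
rewrite -(pair_bigA _ (fun u v => eps (u, v))) -sum_Z4; apply: eq_bigr => u _ /=.
by rewrite -sum_Z4; apply: eq_bigr => v _; rewrite scale1r sig1 mulmx1.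
Qed.

Lemma N_ucol a u : u \in units ->
  N a *m galg_val (ucol u) =
  chi C (pairing (act u.2 (block_weight u.1)) a) *: galg_val (ucol u).
Proof.
move=> /(allP ucol_weight) /allP wt.
rewrite /galg_val mulmx_sumr scaler_sumr !big_seq; apply: eq_bigr => z /wt/eqP zw.
by rewrite -scalemxAr mulmxA N_eps zw -scalemxAl !scalerA mulrC.
Qed.

Definition prim l : 'M[C]_n := 6^-1 *: galg_val (block_prim l).
Definition unit_at (j : 'I_(size units)) : nat * sym3 := tnth (in_tuple units) j.
Definition col_unit j : 'M[C]_n := 6^-1 *: galg_val (ucol (unit_at j)).
Definition row_unit j : 'M[C]_n := 6^-1 *: galg_val (urow (unit_at j)).

Lemma unit_at_in j : unit_at j \in units.
Proof. exact: mem_tnth. Qed.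

Lemma unit_at_inj : injective unit_at.
Proof. by apply/tuple_uniqP; lazy. Qed.

Lemma six_neq0 : (6 : C) != 0. Proof. by rewrite pnatr_eq0. Qed.

Lemma row_col_unit i j :
  row_unit i *m col_unit j = if i == j then prim (unit_at j).1 else 0.
Proof.
have := allP (allP urow_ucol _ (unit_at_in i)) _ (unit_at_in j).
rewrite (inj_eq unit_at_inj) => /galg_valP; rewrite galg_val_mul.
rewrite -scalemxAl -scalemxAr scalerA => ->; case: eqP => _.
  by rewrite galg_val_scale scalerA mulfVK ?six_neq0.
by rewrite galg_val_nil scaler0.
Qed.

Lemma sum_col_row_unit : \sum_j col_unit j *m row_unit j = 1%:M.
Proof.
have := galg_valP ucol_urow.
rewrite galg_val_flatten big_map galg_val_scale galg_val1.
rewrite (big_tnth _ _ units) => e; rewrite -[RHS](scalerK (a := 36)) ?pnatr_eq0 //.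
rewrite -e scaler_sumr; apply: eq_bigr => j _; rewrite galg_val_mul.
by rewrite -scalemxAl -scalemxAr scalerA -invfM -natrM.
Qed.

Lemma col_unit_prim j : col_unit j *m prim (unit_at j).1 = col_unit j.
Proof.
have /galg_valP := allP ucol_prim _ (unit_at_in j).
rewrite galg_val_mul galg_val_scale -scalemxAl -scalemxAr scalerA => ->.
by rewrite scalerA mulfVK ?six_neq0.
Qed.

Lemma prim_row_unit j : prim (unit_at j).1 *m row_unit j = row_unit j.
Proof.
have /galg_valP := allP prim_urow _ (unit_at_in j).
rewrite galg_val_mul galg_val_scale -scalemxAl -scalemxAr scalerA => ->.
by rewrite scalerA mulfVK ?six_neq0.
Qed.

Lemma unit_at_range j : (1 <= (unit_at j).1 <= 10)%N.
Proof.
have : all (fun u => 1 <= u.1 <= 10)%N units by [].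
by move/allP/(_ _ (unit_at_in j)).
Qed.

Lemma base_unit l : (1 <= l <= 10)%N ->
  exists j, [/\ (unit_at j).1 = l, col_unit j = prim l & row_unit j = prim l].
Proof.
move=> l10; have lu : (l, (0, false)) \in units.
  by move: l l10 => [|[|[|[|[|[|[|[|[|[|[|l]]]]]]]]]]].
have [j uj] : exists j, unit_at j = (l, (0, false)).
  by have /(tnthP (in_tuple units))[j e] := lu; exists j.
exists j; rewrite /col_unit /row_unit uj /=; split=> //; congr (_ *: _).
  by rewrite galg_val_lmul3 sig1 mul1mx.
rewrite galg_val_rmul3 [inv3 _](_ : _ = (0, false)); last exact/eqP.
by rewrite sig1 mulmx1.
Qed.

(** This says that [Y] is a combination of matrix units: inserting the sum of all
    [col_unit i *m row_unit i], which is 1, on both sides of [Y] exhibits the coefficients. *)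
Definition blockwise (Y : 'M[C]_n) := forall i j, exists a,
  row_unit i *m Y *m col_unit j =
  if (unit_at i).1 == (unit_at j).1 then a *: prim (unit_at j).1 else 0.

Lemma blockwise_comm X Y : blockwise Y ->
  (forall i j, (unit_at i).1 = (unit_at j).1 ->
     X *m (col_unit i *m row_unit j) = col_unit i *m row_unit j *m X) ->
  X *m Y = Y *m X.
Proof.
move=> bY cX.
have -> : Y = \sum_i \sum_j
    col_unit i *m (row_unit i *m Y *m col_unit j) *m row_unit j.
  rewrite -[LHS]mul1mx -sum_col_row_unit mulmx_suml; apply: eq_bigr => i _.
  rewrite -[LHS]mulmx1 -sum_col_row_unit mulmx_sumr; apply: eq_bigr => j _.
  by rewrite !mulmxA.
rewrite mulmx_sumr mulmx_suml; apply: eq_bigr => i _.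
rewrite mulmx_sumr mulmx_suml; apply: eq_bigr => j _.
have [a ->] := bY i j; case: eqP => [ij|_]; last by rewrite !(mulmx0, mul0mx).
rewrite -ij -(scalemxAr a) col_unit_prim -!(scalemxAl a) -(scalemxAr a).
by rewrite cX.
Qed.

Lemma N_blockwise a : blockwise (N a).
Proof.
move=> i j; rewrite [col_unit j]/col_unit -mulmxA -(scalemxAr 6^-1).
rewrite N_ucol ?unit_at_in // scalerA mulrC -scalerA -/(col_unit j).
rewrite -scalemxAr row_col_unit.
have [-> | ij] := eqVneq i j; first by rewrite eqxx; eexists.
by exists 0; rewrite scaler0 scale0r if_same.
Qed.

Lemma sig_blockwise w : w \in [:: (1, false); (0, true)] -> blockwise (sig w).
Proof.
move=> ww i j.
have := allP (allP (allP urow_sym3_ucol w ww) _ (unit_at_in i)) _ (unit_at_in j).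
set x := galg_mul _ _; set p := block_prim _; set k := (block_weight _, _).
have -> : row_unit i *m sig w *m col_unit j = 36^-1 *: galg_val x.
  rewrite galg_val_mul galg_val_lmul3 /row_unit /col_unit.
  by rewrite -!scalemxAl -scalemxAr scalerA -invfM -natrM mulmxA.
case: eqP => [_ /andP[c0 /galg_valP]|_ /galg_valP->]; last first.
  by exists 0; rewrite galg_val_nil scaler0.
rewrite !galg_val_scale => e.
(* [x] is [p] times the ratio of their coefficients at [k]; of the factor [36^-1], one [6^-1] is
   absorbed by [prim]. *)
exists (6^-1 * ((coef p k)%:~R^-1 * (coef x k)%:~R)).
rewrite -[galg_val x](scalerK (a := (coef p k)%:~R)) ?intr_eq0 // e !scalerA.
congr (_ *: _); rewrite (natrM _ 6 6).
by have := six_neq0; move: c0; rewrite -(intr_eq0 C) => c0 s0; field; rewrite c0.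
Qed.

End GroupAlgebra.

(** * The group acting on the tensor power *)

Section TensorOperators.

Variables (C : numClosedFieldType) (k : nat).

Definition op (X : 'M[C]_3) := tensor_mx k (basis3 C *m X *m cobasis3 C).

Lemma opM X Y : op (X *m Y) = op X *m op Y.
Proof.
rewrite -tensor_mxM; congr tensor_mx; rewrite -!mulmxA; congr (_ *m (_ *m _)).
by rewrite !mulmxA cobasis3K mul1mx.
Qed.

Lemma op1 : op 1%:M = 1%:M.
Proof. by rewrite /op mulmx1 (mulmx1C (cobasis3K C)) tensor_mx1. Qed.

Lemma mxtrace_op X : \tr (op X) = \tr X ^+ k.
Proof. by rewrite mxtrace_tensor_mx mxtrace_mulC mulmxA cobasis3K mul1mx. Qed.

Definition opN a := op (diag3 C a).
Definition opeps := eps opN.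
Definition opsig := sig (op (s3 C)) (op (t3 C)).

Lemma opND a b : opN (a + b) = opN a *m opN b.
Proof. by rewrite -opM -diag3D. Qed.

Lemma opN_eps a x : opN a *m opeps x = chi C (pairing x a) *: opeps x.
Proof. exact: N_eps opND _ _. Qed.

Lemma opeps_mul x y : opeps x *m opeps y = if x == y then opeps x else 0.
Proof. exact: eps_mul opND _ _. Qed.

Lemma sum_opeps : \sum_x opeps x = 1%:M.
Proof. by apply: sum_eps; rewrite /opN diag3_0 op1. Qed.

Lemma opsig_eps w x : opsig w *m opeps x = opeps (act w x) *m opsig w.
Proof.
by apply: sig_eps => a; rewrite -!opM; [rewrite s3_diag3 | rewrite t3_diag3].
Qed.

Lemma opsigM w w' : opsig w *m opsig w' = opsig (mul3 w w').
Proof.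
by apply: sigM; rewrite -!opM ?s3s3 ?t3t3 ?op1 // braid3.
Qed.

Lemma opsig1 : opsig (0, false) = 1%:M. Proof. exact: sig1. Qed.

Definition opprim := prim opeps opsig.

(** * Commuting with D and T, and with the matrix units *)

Section Commutant.

Variable X : 'M[C]_(tensor_dim 3 k).

Let comm (M : 'M[C]_(tensor_dim 3 k)) := X *m M = M *m X.

Lemma comm1 : comm 1%:M. Proof. by rewrite /comm mulmx1 mul1mx. Qed.

Lemma commM M M' : comm M -> comm M' -> comm (M *m M').
Proof. by move=> cM cM'; rewrite /comm mulmxA cM -mulmxA cM' mulmxA. Qed.

Lemma commZ a M : comm M -> comm (a *: M).
Proof. by move=> cM; rewrite /comm -scalemxAr cM scalemxAl. Qed.

Lemma comm_sum (I : Type) (r : seq I) (M : I -> 'M[C]_(tensor_dim 3 k)) :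
  (forall i, comm (M i)) -> comm (\sum_(i <- r) M i).
Proof.
by move=> cM; rewrite /comm mulmx_sumr mulmx_suml; apply: eq_bigr => i _; apply: cM.
Qed.

Lemma commX M j : comm M -> comm (M ^+ j).
Proof.
move=> cM; elim: j => [|j IH]; first exact: comm1.
by rewrite exprS -mulmxE; apply: commM.
Qed.

Let D3 := diag3 C (2, 3) *m s3 C.

Lemma D3D3 : D3 *m D3 = diag3 C (1, 1).
Proof.
rewrite /D3 mulmxA -(mulmxA (diag3 C _)) s3_diag3 -!mulmxA s3s3 mulmx1 -diag3D.
by congr diag3; exact/eqP.
Qed.

(** The square of [D3] is diagonal with exponents [(1, 1)], and its conjugate by [t3] has exponents
    [(1, 2)]. These generate all diagonal matrices, and dividing [D3] by its diagonal part leaves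
    [s3]. *)
Lemma comm_generators : comm (op D3) -> comm (op (t3 C)) ->
  [/\ forall a, comm (opN a), comm (op (s3 C)) & comm (op (t3 C))].
Proof.
move=> cD ct.
have cN a : comm (opN a).
  have c11 : comm (opN (1, 1)) by rewrite /opN -D3D3 opM; apply: commM.
  have c12 : comm (opN (1, 2)).
    rewrite /opN (_ : diag3 C (1, 2) = t3 C *m diag3 C (1, 1) *m t3 C).
      by rewrite !opM; do 2?[apply: commM].
    by rewrite t3_diag3 -mulmxA t3t3 mulmx1; congr diag3; exact/eqP.
  have cNn b j : comm (opN b) -> comm (opN (b *+ j)).
    move=> cb; elim: j => [|j IH]; last by rewrite mulrS opND; apply: commM.
    by rewrite mulr0n /opN diag3_0 op1; apply: comm1.
  (* Coordinates of [a] in the basis [(1, 1)], [(1, 2)] of Z_4 x Z_4. *)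
  rewrite (_ : a = (1, 1) *+ (2 * a.1 - a.2 : 'Z_4)%R
                   + (1, 2) *+ (a.2 - a.1 : 'Z_4)%R).
    by rewrite opND; apply: commM; apply: cNn.
  by case: a => -[[|[|[|[|//]]]] ?] -[[|[|[|[|//]]]] ?]; apply/eqP.
split=> //; have -> : s3 C = diag3 C (2, 1) *m D3.
  by rewrite mulmxA -diag3D (_ : _ + _ = 0) ?diag3_0 ?mul1mx //; exact/eqP.
by rewrite opM; apply: commM => //; apply: cN.
Qed.

Lemma comm_galg_val x : (forall a, comm (opN a)) -> comm (op (s3 C)) ->
  comm (op (t3 C)) -> comm (galg_val opeps opsig x).
Proof.
move=> cN cs ct; apply: comm_sum => z; apply/commZ/commM.
  by apply/commZ/comm_sum => a; apply/commZ/cN.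
by apply: commM; apply: commX => //; apply: commM.
Qed.

(** Diagonal elements, [s t] and [t] are combinations of matrix units, and [s] is recovered as
    [(s t) t]. *)
Lemma comm_units :
  (forall i j, (unit_at i).1 = (unit_at j).1 ->
     comm (col_unit opeps opsig i *m row_unit opeps opsig j)) ->
  comm (op D3) /\ comm (op (t3 C)).
Proof.
move=> cX.
have bw Y : blockwise opeps opsig Y -> comm Y.
  move=> bY.
  exact: (blockwise_comm opeps_mul sum_opeps opsig_eps opsigM opsig1 bY cX).
have cst : comm (op (s3 C) *m op (t3 C)).
  have := bw _ (sig_blockwise opeps_mul opsig_eps opsigM (mem_head _ _)).
  by rewrite /opsig /sig expr1 expr0 [_ *m 1]mulr1.
have ct : comm (op (t3 C)).
  have := bw _ (sig_blockwise opeps_mul opsig_eps opsigM (mem_last _ _)).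
  by rewrite /opsig /sig expr1 expr0 [1 *m _]mul1r.
split=> //; rewrite opM; apply: commM.
  by apply: bw; apply: (N_blockwise opN_eps opeps_mul opsig_eps opsigM).
by rewrite -[op (s3 C)]mulmx1 -op1 -t3t3 opM mulmxA; apply: commM.
Qed.

End Commutant.


(** * Traces and the dimension formulas *)

Definition sym_mx (w : sym3) : 'M[C]_3 := (s3 C *m t3 C) ^+ w.1 *m t3 C ^+ w.2.

Lemma opsigE w : opsig w = op (sym_mx w).
Proof.
have opX Y j : op (Y ^+ j) = op Y ^+ j.
  by elim: j => [|j IH]; [exact: op1 | rewrite !exprS -!mulmxE opM IH].
by rewrite opM !opX opM.
Qed.

Lemma sym_mxE :
  [/\ sym_mx (0, false) = mx3 1 0 0 0 1 0 0 0 1,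
      sym_mx (1, false) = mx3 0 0 1 1 0 0 0 1 0,
      sym_mx (2, false) = mx3 0 1 0 0 0 1 1 0 0
    & [/\ sym_mx (0, true) = t3 C, sym_mx (1, true) = s3 C
    & sym_mx (2, true) = mx3 0 0 (-1) 0 (-1) 0 (-1) 0 0]].
Proof.
rewrite /sym_mx /= !expr0 !expr1 exprS expr1 -!mulmxE -![1]/(1%:M) !mulmx1 !mul1mx.
rewrite -(mulmxA (s3 C) (t3 C) (t3 C)) t3t3 mulmx1 mx3_1.
by rewrite !mx3M; split; [| | |split]; congr mx3; ring.
Qed.

(** The values of i^u + i^v + i^(-u-v). *)
Definition char_table (u v : nat) : C :=
  let a : C := - 1 - 2 * 'i in
  let b : C := - 1 + 2 * 'i in
  nth 0 (nth [::] [:: [:: 3; 1; -1; 1]; [:: 1; b; b; 1];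
                      [:: -1; b; -1; a]; [:: 1; 1; a; a]] u) v.

Definition chi_table (z : 'Z_4) : C := nth 0 [:: 1; 'i; -1; - 'i] z.

Lemma chiE z : chi C z = chi_table z.
Proof.
by case: z => -[|[|[|[|//]]]] ?; rewrite /chi /chi_table /= ?exprS ?expr0 ?mulr1;
  rewrite -?expr2 ?sqrCi ?mulrN1.
Qed.

Lemma mxtrace_diag3 a : \tr (diag3 C a) = char_table a.1 a.2.
Proof.
rewrite mxtrace_mx3 !chiE; case: a => -[[|[|[|[|//]]]] ?] -[[|[|[|[|//]]]] ?].
all: rewrite /chi_table /char_table /=; ring.
Qed.

Ltac eval_chi :=
  repeat match goal with |- context [chi_table ?z] =>
    let n := eval lazy in (nat_of_ord z) in
    change (chi_table z) with (nth 0 [:: 1 : C; 'i; -1; - 'i] n)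
  end.

Lemma sum_weight (V : nmodType) (F : weight -> V) :
  \sum_a F a = \sum_(u <- all_Z4) \sum_(v <- all_Z4) F (u, v).
Proof.
rewrite (eq_bigr (fun a => F (a.1, a.2))) => [|[] //].
rewrite -(pair_bigA _ (fun u v => F (u, v))) sum_Z4; apply: eq_bigr => u _.
by rewrite sum_Z4.
Qed.

(** A reflection fixes one coordinate axis; its sign -1 is the added exponent 2. A nontrivial
    rotation fixes none. *)
Definition mono_trace (a : weight) (w : sym3) : C :=
  if w.2 then nth 0 [:: chi_table (a.1 + 2); chi_table (- a.1 - a.2 + 2);
                        chi_table (a.2 + 2)] w.1
  else nth 0 [:: char_table a.1 a.2; 0; 0] w.1.

Lemma mxtrace_mono a w : \tr (diag3 C a *m sym_mx w) = mono_trace a w.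
Proof.
have [e0 e1 e2 [e3 e4 e5]] := sym_mxE.
case: w => -[[|[|[|//]]] lt3] b; rewrite /mono_trace /= -!chiE !(chiD _ _ 2) chi2.
- rewrite (_ : Ordinal lt3 = 0); last exact: val_inj.
  case: b; rewrite ?e0 ?e3; last by rewrite -mx3_1 mulmx1 mxtrace_diag3.
  by rewrite mx3M mxtrace_mx3; ring.
- rewrite (_ : Ordinal lt3 = 1); last exact: val_inj.
  by case: b; rewrite ?e1 ?e4 mx3M mxtrace_mx3; ring.
- rewrite (_ : Ordinal lt3 = 2); last exact: val_inj.
  by case: b; rewrite ?e2 ?e5 mx3M mxtrace_mx3; ring.
Qed.

Lemma trace_eps_sig x w : \tr (opeps x *m opsig w) = 16^-1 *
  \sum_(u <- all_Z4) \sum_(v <- all_Z4)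
    chi_table (- pairing x (u, v)) * mono_trace (u, v) w ^+ k.
Proof.
rewrite opsigE -scalemxAl mxtraceZ mulmx_suml raddf_sum /=.
rewrite -(sum_weight (fun a => chi_table (- pairing x a) * mono_trace a w ^+ k)).
congr (_ * _); apply: eq_bigr => a _.
by rewrite -scalemxAl mxtraceZ -opM mxtrace_op -chiE mxtrace_mono.
Qed.

Ltac expand_trace :=
  rewrite trace_eps_sig !big_cons !big_nil /mono_trace; eval_chi;
  rewrite /char_table /= ?expr1n.

(** Positivity of [k] enters here: every trace summed is a [k]-th power of 0, which would be 1 for
    [k = 0]. *)
Lemma trace_rotation x j : (0 < k)%N -> j != 0 ->
  \tr (opeps x *m opsig (j, false)) = 0.
Proof.
move=> k0 j0; rewrite trace_eps_sig big1 ?mulr0 // => u _; rewrite big1 // => v _.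
case: j j0 => -[|[|[|//]]] lt3 // _;
  by rewrite /mono_trace /= expr0n eqn0Ngt k0 mulr0.
Qed.

Lemma trace_reflection0 (j : 'Z_3) : \tr (opeps (0, 0) *m opsig (j, true)) =
  4^-1 * (1 + 'i ^+ k + (-1) ^+ k + (- 'i) ^+ k).
Proof.
have [-> | ->|->] : [\/ j = 0, j = 1 | j = 2].
  by case: j => -[|[|[|//]]] lt3; [apply: Or31 | apply: Or32 | apply: Or33];
    exact: val_inj.
all: by expand_trace; field.
Qed.

Lemma trace_reflection1 : \tr (opeps (1, 0) *m opsig (0, true)) =
  4^-1 * (- 1 + 'i * 'i ^+ k + (-1) ^+ k - 'i * (- 'i) ^+ k).
Proof. by expand_trace; field. Qed.

Lemma trace_reflection2 : \tr (opeps (2, 0) *m opsig (0, true)) =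
  4^-1 * (1 - 'i ^+ k + (-1) ^+ k - (- 'i) ^+ k).
Proof. by expand_trace; field. Qed.

Lemma trace_reflection3 : \tr (opeps (3, 0) *m opsig (0, true)) =
  4^-1 * (- 1 - 'i * 'i ^+ k + (-1) ^+ k + 'i * (- 'i) ^+ k).
Proof. by expand_trace; field. Qed.

Let a : C := - 1 - 2 * 'i.
Let b : C := - 1 + 2 * 'i.

Lemma trace_weight0 : \tr (opeps (0, 0) *m opsig (0, false)) =
  16^-1 * (3 ^+ k + 3 * a ^+ k + 3 * b ^+ k + 3 * (-1) ^+ k + 6).
Proof. by expand_trace; rewrite -/a -/b; field. Qed.

Lemma trace_weight1 : \tr (opeps (1, 0) *m opsig (0, false)) =
  16^-1 * (3 ^+ k + b * a ^+ k + a * b ^+ k - (-1) ^+ k + 2).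
Proof.
(* Generalising the powers lets the coefficients [a] and [b] be unfolded without touching [a ^+ k]
   and [b ^+ k]. *)
expand_trace; rewrite -/a -/b; move: (a ^+ k) (b ^+ k) => ak bk.
by rewrite /a /b; field.
Qed.

Lemma trace_weight2 : \tr (opeps (2, 0) *m opsig (0, false)) =
  16^-1 * (3 ^+ k - a ^+ k - b ^+ k + 3 * (-1) ^+ k - 2).
Proof. by expand_trace; rewrite -/a -/b; field. Qed.

Lemma trace_weight3 : \tr (opeps (3, 0) *m opsig (0, false)) =
  16^-1 * (3 ^+ k + a * a ^+ k + b * b ^+ k - (-1) ^+ k + 2).
Proof.
expand_trace; rewrite -/a -/b; move: (a ^+ k) (b ^+ k) => ak bk.
by rewrite /a /b; field.
Qed.

Lemma trace_weight12 : \tr (opeps (1, 2) *m opsig (0, false)) =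
  16^-1 * (3 ^+ k + a ^+ k + b ^+ k - (-1) ^+ k - 2).
Proof. by expand_trace; rewrite -/a -/b; field. Qed.

Lemma mxtrace_prim l : (0 < k)%N -> (1 <= l <= 10)%N ->
  \tr (opprim l) = dims C l k.
Proof.
move=> k0 l10; rewrite mxtraceZ raddf_sum /= big_map.
under eq_bigr do rewrite mxtraceZ /=.
have rot1 x := @trace_rotation x 1 k0 isT.
have rot2 x := @trace_rotation x 2 k0 isT.
case: l l10 => [|[|[|[|[|[|[|[|[|[|[|l]]]]]]]]]]] // _.
all: rewrite /block_weight /= !big_cons !big_nil /= ?rot1 ?rot2.
all: rewrite ?trace_reflection0 ?trace_reflection1 ?trace_reflection2
  ?trace_reflection3 ?trace_weight0 ?trace_weight1 ?trace_weight2 ?trace_weight3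
  ?trace_weight12 -/a -/b; move: (a ^+ k) (b ^+ k) => ak bk.
all: by rewrite /a /b; field.
Qed.

End TensorOperators.

(** * The centralizer algebra of the tensor power *)

Section Centralizer.

Variables (C : numClosedFieldType) (gT : finGroupType) (G : {group gT}) (D T : gT).
Variable rho7 : mx_representation C (G / 'Z(G))%G 3.
Hypothesis gen_DT : <<[set D; T]>>%g = G.
Hypothesis rho7D : rho7 (coset 'Z(G) D) = rho7_D C.
Hypothesis rho7T : rho7 (coset 'Z(G) T) = rho7_T C.

Lemma tensor_repr_D k :
  tensor_repr rho7 k (coset 'Z(G) D) = op k (diag3 C (2, 3) *m s3 C).
Proof. by rewrite tensor_reprE rho7D rho7_DE. Qed.

Lemma tensor_repr_T k : tensor_repr rho7 k (coset 'Z(G) T) = op k (t3 C).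
Proof. by rewrite tensor_reprE rho7T rho7_TE. Qed.

Lemma centgmx_tensorP k X :
  reflect (X *m op k (diag3 C (2, 3) *m s3 C) = op k (diag3 C (2, 3) *m s3 C) *m X
           /\ X *m op k (t3 C) = op k (t3 C) *m X)
          (centgmx (tensor_repr rho7 k) X).
Proof.
have [GD GT] : D \in G /\ T \in G.
  by rewrite -gen_DT !mem_gen ?inE ?eqxx ?orbT.
have GnZ : (G \subset 'N('Z(G)))%g := normal_norm (center_normal G).
have qG x : x \in G -> coset 'Z(G) x \in (G / 'Z(G))%G.
  by move=> Gx; apply: mem_quotient.
apply: (iffP idP) => [/centgmxP cX | [cD cT]].
  by rewrite -tensor_repr_D -tensor_repr_T; split; apply: cX; apply: qG.
(* The elements commuting with [X] form a subgroup of the quotient, whose preimage contains [G] once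
   it contains [D] and [T]. *)
rewrite /centgmx sub_quotient_pre // -{1}gen_DT gen_subG subUset !sub1set.
have nZ x : x \in G -> ('Z(G) :^ x \subset 'Z(G))%g.
  by move=> /(subsetP GnZ); rewrite inE.
by rewrite !inE !nZ // !qG //= tensor_repr_D tensor_repr_T cD cT !eqxx.
Qed.

Lemma cent_alg_tensor k : (1 <= k)%N ->
  exists2 d : nat -> nat, (forall l, (1 <= l <= 10)%N -> (d l)%:R = dims C l k)
    & exists f : {rmorphism cent_alg (tensor_repr rho7 k) ->
          ('M[C]_(d 1%N) * 'M[C]_(d 2%N) * 'M[C]_(d 3%N) * 'M[C]_(d 4%N)
           * 'M[C]_(d 5%N) * 'M[C]_(d 6%N) * 'M[C]_(d 7%N) * 'M[C]_(d 8%N)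
           * 'M[C]_(d 9%N) * 'M[C]_(d 10%N))%type},
        scalable f /\ bijective f.
Proof.
move=> k0.
have rcE := @row_col_unit _ _ _ _ (opeps_mul C k) (opsig_eps C k) (opsigM C k).
have base := @base_unit _ _ _ _ (opsig_eps C k) (opsigM C k) (opsig1 C k).
exists (fun l => \rank (opprim C k l)) => [l l10|].
  rewrite -mxtrace_idem ?mxtrace_prim //; exact: (unit_idem rcE base).
apply: (cent_alg_units (lab := fun j => (unit_at j).1)
  (c := col_unit (opeps C k) (opsig C k)) (r := row_unit (opeps C k) (opsig C k))).
- exact: unit_at_range.
- exact: rcE.
- exact: (sum_col_row_unit (opeps_mul C k) (sum_opeps C k) (opsig_eps C k)
    (opsigM C k) (opsig1 C k)).
- exact: base.
- exact: (col_unit_prim (opeps_mul C k) (opsig_eps C k) (opsigM C k)).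
- exact: (prim_row_unit (opeps_mul C k) (opsig_eps C k) (opsigM C k)).
- move=> X /centgmx_tensorP[cD cT] j; have [cN cs ct] := comm_generators cD cT.
  by apply: commZ; apply: comm_galg_val.
- by move=> X cX; apply/centgmx_tensorP; apply: comm_units.
Qed.

End Centralizer.

Lemma cent_alg_tensor0 (F : fieldType) (gT : finGroupType) (G : {group gT}) n
    (rG : mx_representation F G n) :
  exists f : {rmorphism cent_alg (tensor_repr rG 0) -> F^o},
    scalable f /\ bijective f.
Proof.
pose f (X : cent_alg (tensor_repr rG 0)) : F^o := cent_val X 0 0.
have fB : additive f by move=> X Y; rewrite /f !mxE.
have fM : monoid_morphism f.
  split=> [|X Y]; first by rewrite /f mxE.
  by rewrite /f mxE big_ord1.
pose f1 := GRing.isZmodMorphism.Build _ _ f fB.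
pose f2 := GRing.isMonoidMorphism.Build _ _ f fM.
pose fR : {rmorphism cent_alg (tensor_repr rG 0) -> F^o} := HB.pack f f1 f2.
exists fR; split=> [a X|]; first by rewrite /= /f mxE.
have cent0 (x : F) : centgmx (tensor_repr rG 0) x%:M.
  by apply/centgmxP => g _; rewrite mulmx1 mul1mx.
exists (fun x => CentAlg (cent0 x)) => [X | x]; last by rewrite /= /f mxE.
by apply: val_inj; rewrite /= [RHS]mx11_scalar.
Qed.

Theorem theorem6p1 (R : realType) (gT : finGroupType) (G : {group gT})
    (D T : gT) (presG : presented_by G D T)
    (rho7 : mx_representation R[i] (G / 'Z(G))%G 3)
    (rho7D : rho7 (coset 'Z(G) D) = rho7_D R[i])
    (rho7T : rho7 (coset 'Z(G) T) = rho7_T R[i])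
    (k : nat) :
  (k = 0%N ->
    exists f : {rmorphism cent_alg (tensor_repr rho7 k) -> (R[i])^o},
      scalable f /\ bijective f)
  /\
  ((1 <= k)%N ->
    exists2 d : nat -> nat,
      (forall l, (1 <= l <= 10)%N -> (d l)%:R = dims R[i] l k)
      & exists f : {rmorphism cent_alg (tensor_repr rho7 k) ->
            ('M[R[i]]_(d 1%N) * 'M[R[i]]_(d 2%N) * 'M[R[i]]_(d 3%N) *
             'M[R[i]]_(d 4%N) * 'M[R[i]]_(d 5%N) * 'M[R[i]]_(d 6%N) *
             'M[R[i]]_(d 7%N) * 'M[R[i]]_(d 8%N) * 'M[R[i]]_(d 9%N) *
             'M[R[i]]_(d 10%N))%type},
          scalable f /\ bijective f).
Proof.
have [gen_DT _ _] := presG; split=> [->|k0]; first exact: cent_alg_tensor0.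
exact: (cent_alg_tensor gen_DT rho7D rho7T k0).
Qed.
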